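(* Let $$A_1=\begin{pmatrix}a_1&0\\ a_2&a_4\end{pmatrix},\quad A_2=\begin{pmatrix}\gamma_1&0\\ \gamma_2&a_4\end{pmatrix},\quad B=\begin{pmatrix}b_1\\ b_2\end{pmatrix}$$ be real matrices defining an unobservable planar bimodal linear system, and let $C=(1\;\,0)$. Set $\Delta_1=b_1a_2+(a_4-a_1)b_2$ and $\Delta_2=b_1\gamma_2+(a_4-\gamma_1)b_2$. Then the condition ( * ) for all $\lambda\in\mathbb{R}$, all $v\in\mathbb{R}^2$ with $v\ne 0$, and all $\mu_1,\mu_2\in\mathbb{R}$: if $$\begin{pmatrix}v^t&\mu_i\end{pmatrix}\begin{pmatrix}\lambda I_2-A_i&B\\ C&0\end{pmatrix}=0\quad\text{for both } i=1 \text{ and } i=2,$$ then $\mu_1\mu_2>0$, is equivalent to $$b_1\ne 0\quad\text{and}\quad \Delta_1\Delta_2>0.$$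
   Context: A planar bimodal linear system is given by a triple $(A_1,A_2,B)\in M_2(\mathbb{R})\times M_2(\mathbb{R})\times M_{2\times 1}(\mathbb{R})$ such that $A_1$ and $A_2$ have the same second column, together with $C=(1\;\,0)$; the two dynamics act on $Cx\le 0$ and $Cx\ge 0$ respectively. The system is observable if $\operatorname{rank}\begin{pmatrix}C\\ CA_i\end{pmatrix}=2$ for $i=1,2$, and unobservable otherwise; unobservability means exactly that the $(1,2)$ entry common to $A_1$ and $A_2$ is zero, so the matrices displayed in the claim are the general form of an unobservable planar system. *)

(* Defs.v *)
From HB Require Import structures.
From mathcomp Require Import all_boot all_order all_algebra.
From mathcomp Require Import reals.

Set Implicit Arguments.
Unset Strict Implicit.
Unset Printing Implicit Defensive.

Import Order.TTheory GRing.Theory Num.Theory.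
Local Open Scope ring_scope.

Definition mx2 (R : realType) (a b c d : R) : 'M[R]_2 :=
  \matrix_(i, j) (if i == 0 then if j == 0 then a else b
                  else if j == 0 then c else d).

Definition cv2 (R : realType) (b1 b2 : R) : 'cV[R]_2 :=
  \col_i (if i == 0 then b1 else b2).

(* The output matrix C = (1 0). *)
Definition outC (R : realType) : 'rV[R]_2 := \row_j (if j == 0 then 1 else 0).
Arguments outC {R}.

(* The matrices A1, A2 of a planar bimodal system agree on their second column;
   continuity across the line C x = 0 is exactly this condition. *)
Definition bimodal (R : realType) (A1 A2 : 'M[R]_2) : Prop :=
  col 1 A1 = col 1 A2.

Definition observable (R : realType) (A1 A2 : 'M[R]_2) : Prop :=
  \rank (col_mx outC (outC *m A1)) = 2%N /\
  \rank (col_mx outC (outC *m A2)) = 2%N.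

Definition unobservable (R : realType) (A1 A2 : 'M[R]_2) : Prop :=
  ~ observable A1 A2.

Lemma rank_obs (R : realType) (A : 'M[R]_2) :
  \rank (col_mx outC (outC *m A)) = 2%N <-> A 0 1 <> 0.
Proof.
set M := col_mx _ _.
have M0 j : (M : 'M_2) 0 j = outC 0 j.
  have -> : 0 = @lshift 1 1 0 :> 'I_2 by apply: val_inj.
  exact: col_mxEu.
have M1 j : (M : 'M_2) 1 j = A 0 j.
  transitivity ((outC *m A) 0 j).
    have -> : 1 = @rshift 1 1 0 :> 'I_2 by apply: val_inj.
    exact: col_mxEd.
  by rewrite !mxE !big_ord_recl big_ord0 !mxE /= mul1r mul0r !addr0.
have detM : \det (M : 'M_2) = A 0 1.
  have e1 : lift 0 0 = 1 :> 'I_2 by apply: val_inj.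
  rewrite (expand_det_row _ 0) !big_ord_recl big_ord0 addr0 !M0 !mxE /=.
  rewrite mul0r addr0 mul1r /cofactor det_mx11 mxE mxE /= addn0 expr0 mul1r.
  by rewrite e1 M1.
have := unitmxE (M : 'M_2); rewrite detM unitfE -row_full_unit /row_full => e.
split=> [/eqP|]; first by rewrite e => /eqP.
by move/eqP; rewrite -e => /eqP.
Qed.

(* So the matrices mx2 a1 0 a2 a4 and mx2 g1 0 g2 a4 need no separate
   unobservability hypothesis. *)
Lemma unobservableP (R : realType) (A1 A2 : 'M[R]_2) :
  bimodal A1 A2 /\ unobservable A1 A2 <->
  exists a1 a2 g1 g2 a4, A1 = mx2 a1 0 a2 a4 /\ A2 = mx2 g1 0 g2 a4.
Proof.
rewrite /unobservable /observable; split.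
  case=> /colP e; have e0 := e 0; have e1 := e 1; rewrite !mxE in e0 e1.
  rewrite !rank_obs -e0 => h.
  have z : A1 0 1 = 0 by apply/eqP; case: eqP => // n; case: h.
  exists (A1 0 0), (A1 1 0), (A2 0 0), (A2 1 0), (A1 1 1).
  have ord2 (i : 'I_2) : i = 0 \/ i = 1.
    by case: i => [[|[|//]] p]; [left|right]; apply: val_inj.
  split; apply/matrixP=> i j; rewrite mxE;
    by case: (ord2 i) => ->; case: (ord2 j) => -> //=; rewrite -?e0 -?e1.
case=> a1 [a2 [g1 [g2 [a4 [-> ->]]]]]; split.
  by apply/colP=> i; rewrite !mxE.
by rewrite !rank_obs !mxE /=; case.
Qed.

(* Main.v *)
(* Write v = (x, y). The pencil equation reads mu_i = y a2 - x (lambda - a1)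
   (resp. with gamma), y (lambda - a4) = 0 and x b1 + y b2 = 0. If b1 <> 0 then
   y <> 0, so lambda = a4 and b1 mu_i = y Delta_i. If b1 = 0 then v = (1, 0) is
   a solution for every lambda, and lambda = a1 gives mu_1 = 0. *)
Require Import Defs.
From HB Require Import structures.
From mathcomp Require Import all_boot all_order all_algebra.
From mathcomp Require Import reals ring.

Set Implicit Arguments.
Unset Strict Implicit.
Unset Printing Implicit Defensive.

Import Order.TTheory GRing.Theory Num.Theory.
Local Open Scope ring_scope.

(** Reads the matrix equation column by column. In the second column the zero upper-right entry of
    the system matrix removes [v 0 0], and the zero entry of [outC] removes [mu]. *)
Lemma pencil_eq0P (R : realType) (lambda a c d b1 b2 mu : R) (v : 'cV[R]_2) :
  row_mx v^T mu%:M *m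
    block_mx (lambda%:M - mx2 a 0 c d) (cv2 b1 b2) outC 0 = 0 <->
  [/\ v 0 0 * (lambda - a) - v 1 0 * c + mu = 0,
      v 1 0 * (lambda - d) = 0 & v 0 0 * b1 + v 1 0 * b2 = 0].
Proof.
have ord2 (i : 'I_2) : i = 0 \/ i = 1.
  by case: i => [[|[|//]] p]; [left|right]; apply: val_inj.
have e1 : lift 0 0 = 1 :> 'I_2 by apply: val_inj.
rewrite mul_row_block mul_scalar_mx mulmx0 addr0.
set L := _ + _ *: _; set r := _ *m _.
have L0 : L 0 0 = v 0 0 * (lambda - a) - v 1 0 * c + mu.
  by rewrite !mxE !big_ord_recl big_ord0 !mxE /= e1; ring.
have L1 : L 0 1 = v 1 0 * (lambda - d).
  by rewrite !mxE !big_ord_recl big_ord0 !mxE /= e1; ring.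
have r0 : r 0 0 = v 0 0 * b1 + v 1 0 * b2.
  by rewrite !mxE !big_ord_recl big_ord0 !mxE /= e1 addr0.
rewrite -L0 -L1 -r0; split.
  by move/eqP; rewrite row_mx_eq0 => /andP[/eqP-> /eqP->]; rewrite !mxE.
move=> [z0 z1 zr]; apply/eqP; rewrite row_mx_eq0; apply/andP.
split; apply/eqP/rowP=> j; rewrite [RHS]mxE; last by rewrite ord1.
by case: (ord2 j) => ->.
Qed.

Lemma cv2_eq0 (R : realType) (v : 'cV[R]_2) : v 0 0 = 0 -> v 1 0 = 0 -> v = 0.
Proof.
move=> v0 v1; apply/colP=> i; rewrite [RHS]mxE.
case: i => [[|[|//]] p]; [rewrite -[RHS]v0 | rewrite -[RHS]v1];
  by congr (v _ _); apply: val_inj.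
Qed.

(** Taking [b1] times the first equation minus [d - a] times the second eliminates [x]. *)
Lemma pencil_mul_mu (R : comPzRingType) (x y a c d b1 b2 mu : R) :
  x * (d - a) - y * c + mu = 0 -> x * b1 + y * b2 = 0 ->
  b1 * mu = y * (b1 * c + (d - a) * b2).
Proof.
move=> emu ex; rewrite -[LHS]subr0 -(mulr0 b1) -emu -[RHS]subr0.
by rewrite -(mulr0 (d - a)) -ex; ring.
Qed.

Theorem proposition8 (R : realType) (a1 a2 a4 gamma1 gamma2 b1 b2 : R) :
  let A1 := mx2 a1 0 a2 a4 in
  let A2 := mx2 gamma1 0 gamma2 a4 in
  let B := cv2 b1 b2 in
  let Delta1 := b1 * a2 + (a4 - a1) * b2 in
  let Delta2 := b1 * gamma2 + (a4 - gamma1) * b2 in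
  (forall (lambda : R) (v : 'cV[R]_2) (mu1 mu2 : R),
     v <> 0 ->
     row_mx v^T mu1%:M *m block_mx (lambda%:M - A1) B outC 0 = 0 ->
     row_mx v^T mu2%:M *m block_mx (lambda%:M - A2) B outC 0 = 0 ->
     0 < mu1 * mu2)
  <->
  (b1 <> 0 /\ 0 < Delta1 * Delta2).
Proof.
move=> A1 A2 B Delta1 Delta2; split=> [H | [/eqP b1_neq0 D_gt0] l v mu1 mu2 v_neq0].
  have b1_neq0 : b1 != 0.
    (* At [lambda = a1] and [v = (1, 0)] the first scalar equation forces [mu1 = 0] and
       [mu2 = gamma1 - a1]. *)
    apply/eqP=> b1_0; suff : 0 < 0 * (gamma1 - a1) by rewrite mul0r ltxx.
    apply: (H a1 (cv2 1 0)).
    - by move/colP/(_ 0); rewrite !mxE /= => /eqP; rewrite oner_eq0.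
    - by apply/pencil_eq0P; rewrite !mxE /= b1_0; split; ring.
    - by apply/pencil_eq0P; rewrite !mxE /= b1_0; split; ring.
  split; first exact/eqP.
  (* The vector [(- b2, b1)] is orthogonal to [B], and at [lambda = a4] it gives exactly
     [mu1 = Delta1] and [mu2 = Delta2]. *)
  apply: (H a4 (cv2 (- b2) b1)).
  - by move/colP/(_ 1); rewrite !mxE /=; apply/eqP.
  - by apply/pencil_eq0P; rewrite !mxE /= /Delta1; split; ring.
  - by apply/pencil_eq0P; rewrite !mxE /= /Delta2; split; ring.
move=> /pencil_eq0P[e1 ey ex] /pencil_eq0P[e2 _ _].
(* If [v 1 0 = 0], orthogonality to [B] leaves [v 0 0 * b1 = 0], so [v = 0]. *)
have y_neq0 : v 1 0 != 0.
  apply/eqP=> y0; apply: v_neq0; apply: cv2_eq0 => //.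
  move/eqP: ex; rewrite y0 mul0r addr0 mulf_eq0 (negPf b1_neq0) orbF.
  by move/eqP.
have la4 : l = a4.
  by move/eqP: ey; rewrite mulf_eq0 (negPf y_neq0) subr_eq0 => /eqP.
rewrite la4 in e1 e2.
have m1 : b1 * mu1 = v 1 0 * Delta1 := pencil_mul_mu e1 ex.
have m2 : b1 * mu2 = v 1 0 * Delta2 := pencil_mul_mu e2 ex.
(* The product of the two identities has positive squares as factors on both sides, so [mu1 * mu2]
   takes the sign of [Delta1 * Delta2]. *)
have mm : b1 ^+ 2 * (mu1 * mu2) = v 1 0 ^+ 2 * (Delta1 * Delta2).
  by rewrite !expr2 mulrACA m1 m2 mulrACA.
have b1_sq_gt0 : 0 < b1 ^+ 2 by rewrite exprn_even_gt0.
by rewrite -(pmulr_rgt0 _ b1_sq_gt0) mm mulr_gt0 ?exprn_even_gt0.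
Qed.
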